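(* Let $k\in\mathbb{N}$ and let $p$ be a positive integer. Let $C(m)=\binom{2m}{m+k}=\frac{\Gamma(2m+1)}{\Gamma(m+k+1)\Gamma(m-k+1)}$, which is analytic in $m$ near $m=0$. Then $$C^{(p)}(0)=\frac{(-1)^{p+k}}{k}\,p\,B_{p-1}(\overline{\xi}_1,\overline{\xi}_2,\dots,\overline{\xi}_{p-1}),$$ where for $j\ge1$ $$\overline{\xi}_j=(-2)^j\psi^{(j-1)}(1)+2\,[j\text{ odd}]\,\psi^{(j-1)}(k)-2\,[j\text{ even}]\,\psi^{(j-1)}(1)+\frac{(j-1)!}{k^j}.$$
   Context: $1/\Gamma$ is entire. $\psi^{(n)}(z)=\frac{d^{n+1}}{dz^{n+1}}\log\Gamma(z)$ is the polygamma function ($\psi^{(0)}=\psi$ the digamma function). $[\,\cdot\,]$ is $1$ if the condition holds and $0$ otherwise. $B_n(s_1,\dots,s_n)$ denotes the complete Bell polynomial, defined by $\exp\big(\sum_{j\ge1}s_j t^j/j!\big)=\sum_{n\ge0}B_n(s_1,\dots,s_n)t^n/n!$; in particular $B_0=1$. *)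

(* Defs.v *)
From HB Require Import structures.
From mathcomp Require Import all_boot all_order all_algebra.
From mathcomp Require Import all_classical all_reals all_analysis.
Set Implicit Arguments. Unset Strict Implicit. Unset Printing Implicit Defensive.
Import Order.TTheory GRing.Theory Num.Theory.
Local Open Scope classical_set_scope.
Local Open Scope ring_scope.

Section Defs.
Variable R : realType.

(* Euler's Gamma function for x > 0: \int_0^oo t^(x-1) e^(-t) dt
   (Lebesgue integral; only used at points x > 0). *)
Definition Gamma (x : R) : R :=
  Rintegral (@lebesgue_measure R) `]0%R, +oo[
            (fun t : R => (t `^ (x - 1)) * expR (- t)).

(* Number of shifts used to continue 1/Gamma: N x is such that x + N x > 0. *)
Definition rgamma_shift (x : R) : nat := (`|Num.floor x|%N).+1.

(* Reciprocal Gamma 1/Gamma, as an entire function, via the functional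
   equation: 1/Gamma(x) = x (x+1) ... (x+N-1) / Gamma(x+N), any N with x+N>0. *)
Definition rgamma (x : R) : R :=
  (\prod_(i < rgamma_shift x) (x + i%:R)) / Gamma (x + (rgamma_shift x)%:R).

Definition polygamma (n : nat) (x : R) : R :=
  derive1n n.+1 (fun y : R => ln (Gamma y)) x.

(* Complete Bell polynomial B_n(s_1,...,s_n): n! times the coefficient of t^n in
   exp(sum_{j>=1} s_j t^j / j!).  Since the inner series has no constant term,
   this coefficient is that of sum_{m=0}^n P(t)^m/m!, P(t) = sum_{j=1}^n s_j t^j/j!. *)
Definition bell (n : nat) (s : nat -> R) : R :=
  let P : {poly R} := \poly_(j < n.+1) (if j == 0%N then 0 else s j / j`!%:R) in
  n`!%:R * (\sum_(m < n.+1) (m`!%:R)^-1 *: P ^+ m)`_n.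

Definition Cbin (k : nat) (m : R) : R :=
  Gamma (2 * m + 1) * rgamma (m + k%:R + 1) * rgamma (m - k%:R + 1).

Definition xibar (k : nat) (j : nat) : R :=
  (-2) ^+ j * polygamma j.-1 1
  + 2 * (odd j)%:R * polygamma j.-1 k%:R
  - 2 * (~~ odd j)%:R * polygamma j.-1 1
  + (j.-1)`!%:R / k%:R ^+ j.

End Defs.

(* Main.v *)
(* Near m = 0, the functional equation of Gamma gives
     C(m) = m (-1)^(k-1) exp(L(m)),
     L(m) = lnG(2m+1) - lnG(m+k+1) - lnG(m+1) + lnG(k-m) - lnG(1-m),
   where lnG is the logarithm of Gamma.  Since L(0) = - ln k and
   L^(j)(0) = (-1)^j xibar_j, and since the derivatives of exp(L) are exp(L)
   times complete Bell polynomials in the derivatives of L, Leibniz' rule for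
   the factor m gives the formula.  All the Gamma function needs to provide is
   smoothness on ]0, +oo[, Gamma(x+1) = x Gamma(x), positivity and Gamma(1) = 1. *)

Require Import Defs.
From HB Require Import structures.
From mathcomp Require Import all_boot all_order all_algebra.
From mathcomp Require Import all_classical all_reals all_analysis.
From mathcomp Require Import measurable_realfun zify ring lra.
Set Implicit Arguments.
Unset Strict Implicit.
Unset Printing Implicit Defensive.
Import Order.TTheory GRing.Theory Num.Theory.
Import numFieldNormedType.Exports.
Local Open Scope ring_scope.
Local Open Scope classical_set_scope.

(** * The Gamma function *)

Section gamma_integral.
Context {R : realType}.
Implicit Types (s t x : R) (n : nat).
Local Notation mu := (@lebesgue_measure R).

(* Starting at n.+2 keeps the endpoints distinct for every n. *)
Definition exhaust n : set R := `[(n.+2%:R)^-1, n.+2%:R].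

Lemma exhaust_gt0 n t : exhaust n t -> 0 < t.
Proof.
by rewrite /exhaust/= in_itv/= => /andP[+ _]; apply: lt_le_trans; rewrite invr_gt0.
Qed.

Lemma bigcup_exhaust : \bigcup_n exhaust n = `]0, +oo[.
Proof.
apply/seteqP; split=> [t [n _ /exhaust_gt0]|t]; rewrite /= in_itv/= andbT// => t0.
(* Bounding the sum bounds [t] and [t^-1] at once, hence both endpoints. *)
pose N := Num.truncn (t + t^-1).
have Nt : t + t^-1 <= N.+2%:R.
  apply: (le_trans (ltW (truncnS_gt _))).
  by rewrite ler_nat.
have ti : 0 < t^-1 by rewrite invr_gt0.
exists N => //; rewrite /exhaust/= in_itv/=; apply/andP; split; last lra.
by rewrite -[leRHS]invrK lef_pV2 ?posrE//; lra.
Qed.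

Lemma nondecreasing_exhaust : nondecreasing_seq exhaust.
Proof.
move=> m n mn; apply/subsetPset => t; rewrite /exhaust/= !in_itv/= => /andP[mt tm].
apply/andP; split; last by rewrite (le_trans tm)// ler_nat.
by apply: le_trans mt; rewrite lef_pV2 ?posrE// ler_nat.
Qed.

Lemma integral_exhaust (f : R -> R) : measurable_fun (`]0, +oo[ : set R) f ->
  (forall t, 0 < t -> 0 <= f t) ->
  (\int[mu]_(t in exhaust n) (f t)%:E)%E @[n --> \oo] -->
  (\int[mu]_(t in `]0%R, +oo[) (f t)%:E)%E.
Proof.
move=> mf f0; rewrite -bigcup_exhaust.
apply: ge0_nondecreasing_set_cvg_integral => //.
- exact: nondecreasing_exhaust.
- by move=> n; exact: measurable_itv.
- move=> n; apply/measurable_EFinP; apply: measurable_funS mf => //.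
  by move=> t /exhaust_gt0; rewrite /= in_itv/= andbT.
- by move=> n t /exhaust_gt0 t0; rewrite lee_fin f0.
Qed.

Lemma integral_exhaust_FTC (F f : R -> R) n :
  (forall t, 0 < t -> is_derive t 1 F (f t)) ->
  (forall t, 0 < t -> {for t, continuous f}) ->
  (\int[mu]_(t in exhaust n) (f t)%:E = (F n.+2%:R - F (n.+2%:R)^-1)%:E)%E.
Proof.
move=> dF cf; rewrite EFinB.
have n0 : 0 < n.+2%:R :> R by [].
have ni0 : 0 < (n.+2%:R)^-1 :> R by rewrite invr_gt0.
have cF t : 0 < t -> {for t, continuous F}.
  by move=> /dF[dFt _]; exact/differentiable_continuous/derivable1_diffP.
apply: continuous_FTC2.
- apply: (@lt_trans _ _ 1); last by rewrite ltr1n.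
  by rewrite invf_lt1// ltr1n.
- apply: continuous_in_subspaceT => t; rewrite inE => /exhaust_gt0; exact: cf.
- split.
  + move=> t; rewrite in_itv/= => /andP[/(lt_trans ni0) /dF[? _] _]//.
  + by apply: cvg_at_right_filter; exact: cF.
  + by apply: cvg_at_left_filter; exact: cF.
- move=> t; rewrite in_itv/= => /andP[/(lt_trans ni0) /dF[? <-] _].
  by rewrite derive1E.
Qed.

Definition gamma_density s t : R := t `^ (s - 1) * expR (- t).

Lemma gamma_density_ge0 s t : 0 <= gamma_density s t.
Proof. by rewrite mulr_ge0 ?powR_ge0 ?expR_ge0. Qed.

Lemma measurable_gamma_density s (D : set R) :
  measurable_fun D (gamma_density s).
Proof.
apply: measurable_funTS; apply: measurable_funM; first exact: measurable_powR.
by apply: measurableT_comp => //; exact: oppr_measurable.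
Qed.

Lemma continuous_powR s t : 0 < t -> {for t, continuous (@powR R ^~ s)}.
Proof.
move=> t0; apply/differentiable_continuous/derivable1_diffP.
by apply: derivable_powR; rewrite in_itv/= t0.
Qed.

Lemma is_derive_gamma_density s t : 0 < t ->
  is_derive t 1 (gamma_density s)
    ((s - 1) * gamma_density (s - 1) t - gamma_density s t).
Proof.
move=> t0; have dp := is_derive1_powR (s - 1) t0.
have de : is_derive t 1 (fun u : R => expR (- u)) (- expR (- t)).
  by rewrite -mulrN1; apply: (@is_derive1_comp _ expR -%R).
rewrite /gamma_density; apply: (is_derive_eq (is_deriveM dp de)).
by rewrite /GRing.scale/=; ring.
Qed.

Lemma continuous_gamma_density s t : 0 < t -> {for t, continuous (gamma_density s)}.
Proof.
move=> /(is_derive_gamma_density s)[d _].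
exact/differentiable_continuous/derivable1_diffP.
Qed.

(* Bounds the Gamma density by a multiple of the derivative of the bounded
   function t |-> - (1 + t^s)^-1, and t^s e^-t by a multiple of both t^s and t^-s. *)
Lemma sqr_powR_expR_bounded s : 0 < s ->
  exists2 C, 0 < C & forall t, 0 < t -> (1 + t `^ s) ^+ 2 * expR (- t) <= C.
Proof.
move=> s0; pose N := (Num.truncn (2 * s)).+1.
have sN : 2 * s <= N%:R by exact/ltW/truncnS_gt.
have f0 : 0 < N`!%:R :> R by rewrite ltr0n fact_gt0.
(* With q = t^s, (1+q)^2 <= 2(1+q^2) <= 4 + 2t^N, where t^N <= N! e^t by the exponential series and
   1 <= e^t. *)
exists (4 * (1 + N`!%:R)); first lra.
move=> t t0.
have p0 := powR_ge0 t s.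
have et1 : 1 <= expR t by rewrite -expR0 ler_expR ltW.
have tNe : t ^+ N <= N`!%:R * expR t.
  have := expR_ge1Dxn N.-1 (ltW t0); rewrite /N/= -/N => h.
  rewrite mulrC -ler_pdivrMr//; lra.
have p2 : (t `^ s) ^+ 2 <= 1 + t ^+ N.
  rewrite -powR_mulrn// -powRrM mulrC.
  have [t1|t1] := leP t 1.
    apply: (@le_trans _ _ 1); last by rewrite lerDl exprn_ge0// ltW.
    by rewrite -[leRHS](congr1 (@^~ (2 * s)) (powR1 R)) ge0_ler_powR ?nnegrE//; lra.
  apply: (@le_trans _ _ (t ^+ N)); last by rewrite lerDr.
  by rewrite -powR_mulrn ?ler_powR// ltW.
rewrite expRN ler_pdivrMr ?expR_gt0//.
have : (1 + t `^ s) ^+ 2 <= 2 * (1 + (t `^ s) ^+ 2).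
  by rewrite -subr_ge0 (_ : _ - _ = (1 - t `^ s) ^+ 2) ?sqr_ge0//; ring.
nra.
Qed.

(** Comparison with f = F', where F = -(1+t^s)^-1 takes values in [-1, 0]: integrals of f over the
    exhaustion stay below 1, and the density is at most (C/s) f. This treats both ends of the
    half-line at once. *)
Lemma integrable_gamma_density s : 0 < s ->
  mu.-integrable `]0, +oo[ (EFin \o gamma_density s).
Proof.
move=> s0; have [C C0 HC] := sqr_powR_expR_bounded s0.
pose F t : R := - (1 + t `^ s)^-1.
pose f t : R := s * t `^ (s - 1) / (1 + t `^ s) ^+ 2.
have q0 t : 0 < 1 + t `^ s by rewrite ltr_wpDr ?powR_ge0.
have cf t : 0 < t -> {for t, continuous f}.
  move=> t0.
  have cq : {for t, continuous (fun u : R => 1 + u `^ s)}.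
    by apply: continuousD; [exact: cst_continuous|exact: continuous_powR].
  apply: continuousM.
    by apply: continuousM; [exact: cst_continuous|exact: continuous_powR].
  apply: continuousV; first by rewrite expf_neq0// gt_eqF.
  exact: (@continuous_comp _ _ _ _ (fun u : R => u ^+ 2) _ cq (@exprn_continuous _ 2 _)).
have mf : measurable_fun (`]0, +oo[ : set R) f.
  apply: open_continuous_measurable_fun; first exact: interval_open.
  by move=> t; rewrite inE/= in_itv/= andbT; exact: cf.
have dF t : 0 < t -> is_derive t 1 F (f t).
  move=> t0.
  have h : is_derive t 1 (fun u : R => 1 + u `^ s) (s * t `^ (s - 1)).
    have h := is_deriveD (is_derive_cst (1 : R) t 1) (is_derive1_powR s t0).
    by apply: (is_derive_eq h); rewrite add0r.
  have h' := is_deriveN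
    (@is_deriveV _ (fun u : R => 1 + u `^ s) _ _ _ (lt0r_neq0 (q0 t)) h).
  by apply: (is_derive_eq h'); rewrite scaleNr opprK /GRing.scale/= mulrC.
have f0 t : 0 < t -> 0 <= f t.
  by move=> t0; rewrite divr_ge0 ?sqr_ge0// mulr_ge0 ?powR_ge0// ltW.
have intf : mu.-integrable `]0, +oo[ (EFin \o f).
  apply/integrableP; split; first exact/measurable_EFinP.
  apply: (@le_lt_trans _ _ (1%:E)); last exact: ltry.
  rewrite (_ : (\int[mu]_(x in _) _ =
    \int[mu]_(x in `]0%R, +oo[) (f x)%:E)%E); last first.
    apply: eq_integral => t; rewrite inE/= in_itv/= andbT => t0.
    by rewrite /= ger0_norm ?f0.
  have /cvg_lim <- // := integral_exhaust mf f0.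
  apply: lime_le.
    by apply/cvg_ex; eexists; exact: integral_exhaust.
  apply: nearW => n; rewrite (integral_exhaust_FTC _ dF cf) lee_fin /F.
  have /ltW := q0 n.+2%:R; rewrite -invr_ge0.
  have : (1 + (n.+2%:R^-1) `^ s)^-1 <= 1 by rewrite invf_le1// lerDl powR_ge0.
  lra.
have intCf : mu.-integrable `]0, +oo[ (EFin \o (fun t => C / s * f t)).
  exact: (integrableZl _ (C / s) intf).
apply: le_integrable intCf => //.
  by apply/measurable_EFinP; exact: measurable_gamma_density.
move=> t; rewrite /= in_itv/= andbT => t0.
rewrite lee_fin ger0_norm ?gamma_density_ge0//.
rewrite ger0_norm; last by rewrite mulr_ge0 ?f0// divr_ge0 ?ltW//.
rewrite /f /gamma_density mulrA (mulrA (C / s)) divfK ?gt_eqF//.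
rewrite ler_pdivlMr ?exprn_gt0//.
have := HC t t0; have := powR_ge0 t (s - 1); nra.
Qed.

End gamma_integral.

(** * Functional equation, value at 1 and positivity of Gamma *)

Section gamma_function.
Context {R : realType}.
Implicit Types (s t x : R) (n : nat).
Local Notation mu := (@lebesgue_measure R).

Lemma cvg_Gamma_exhaust x : 0 < x ->
  \int[mu]_(t in exhaust n) gamma_density x t @[n --> \oo] --> Gamma x.
Proof.
move=> x0; apply: fine_cvg; rewrite fineK; last first.
  by apply: integrable_fin_num => //; exact: integrable_gamma_density.
apply: integral_exhaust; first exact: measurable_gamma_density.
by move=> t _; exact: gamma_density_ge0.
Qed.

Lemma integrable_gamma_density_exhaust x n : 0 < x ->
  mu.-integrable (exhaust n) (EFin \o gamma_density x).
Proof.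
move=> x0; apply: integrableS (integrable_gamma_density x0) => //.
  exact: measurable_itv.
by move=> t /exhaust_gt0; rewrite /= in_itv/= andbT.
Qed.

(** These are the boundary terms of the integration by parts in [GammaD1]. Since t^x e^-t is at most
    C t^x and at most C t^-x, each is at most C (n+2)^-x. *)
Lemma cvg_gamma_density_ends x : 0 < x ->
  gamma_density (x + 1) n.+2%:R - gamma_density (x + 1) n.+2%:R^-1
    @[n --> \oo] --> 0.
Proof.
move=> x0; have [C C0 HC] := sqr_powR_expR_bounded x0.
have cvg0 : C * n.+2%:R^-1 `^ x @[n --> \oo] --> 0.
  rewrite -[X in _ --> X](mulr0 C); apply: cvgM; first exact: cvg_cst.
  move: (cvg_at_rightP (@powR R ^~ x) 0 0) => [/(_ (powR_cvg0 x0)) + _]; apply.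
  split=> [n|]; first by rewrite invr_gt0.
  by have := @cvg_harmonic R; rewrite -cvg_shiftS.
have le t : 0 < t -> gamma_density (x + 1) t * (1 + t `^ x) ^+ 2 <= C * t `^ x.
  move=> t0; rewrite /gamma_density addrK.
  by have := HC t t0; have := powR_ge0 t x; nra.
have le0 t : 0 < t -> gamma_density (x + 1) t <= C * t `^ x.
  move=> t0; have := le t t0.
  by have := powR_ge0 t x; have := gamma_density_ge0 (x + 1) t; nra.
have ley t : 0 < t -> gamma_density (x + 1) t <= C * t^-1 `^ x.
  move=> t0; rewrite -powR_inv1 ?(ltW t0)// -powRrM mulN1r powRN.
  rewrite ler_pdivlMr ?powR_gt0//.
  have := le t t0; have := powR_gt0 x t0; have := gamma_density_ge0 (x + 1) t.
  set p := t `^ x; set g := gamma_density _ _ => g0 p0 H.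
  suff : p * (g * p) <= p * C by rewrite ler_pM2l.
  nra.
have cvg0N : - (C * n.+2%:R^-1 `^ x) @[n --> \oo] --> 0.
  by rewrite -[X in _ --> X]oppr0; exact: (@cvgN _ _ _ _ _ _ _ cvg0).
apply: (squeeze_cvgr _ cvg0N cvg0); apply: nearW => n.
have n0 : 0 < n.+2%:R :> R by [].
have ni0 : 0 < n.+2%:R^-1 :> R by rewrite invr_gt0.
have := ley _ n0; have := le0 _ ni0.
have := gamma_density_ge0 (x + 1) n.+2%:R.
have := gamma_density_ge0 (x + 1) n.+2%:R^-1.
by move=> *; apply/andP; split; lra.
Qed.

(** Integration by parts on each compact interval: x t^(x-1) e^-t - t^x e^-t is the derivative of
    t^x e^-t, so its integral is a difference of boundary values, which tends to 0. *)
Lemma GammaD1 x : 0 < x -> Gamma (x + 1) = x * Gamma x.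
Proof.
move=> x0; have x10 : 0 < x + 1 by lra.
have cl : x * (\int[mu]_(t in exhaust n) gamma_density x t) -
   \int[mu]_(t in exhaust n) gamma_density (x + 1) t @[n --> \oo] -->
   x * Gamma x - Gamma (x + 1).
  apply: cvgB; last exact: cvg_Gamma_exhaust.
  by apply: cvgM; [exact: cvg_cst|exact: cvg_Gamma_exhaust].
apply/eqP; rewrite eq_sym -subr_eq0; apply/eqP.
apply: (cvg_unique _ cl) => //.
apply: cvg_trans (cvg_gamma_density_ends x0); apply: near_eq_cvg; apply: nearW => n.
have mE : measurable (exhaust n : set R) by exact: measurable_itv.
rewrite -RintegralZl//; last exact: integrable_gamma_density_exhaust.
rewrite -RintegralB//; last 2 first.
- exact: (integrableZl _ x (integrable_gamma_density_exhaust n x0)).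
- exact: integrable_gamma_density_exhaust.
have dF t : 0 < t -> is_derive t 1 (gamma_density (x + 1))
    (x * gamma_density x t - gamma_density (x + 1) t).
  by move=> /(is_derive_gamma_density (x + 1)); rewrite addrK.
rewrite /Rintegral (integral_exhaust_FTC _ dF)//.
  move=> t t0; apply: continuousB; last exact: continuous_gamma_density.
  by apply: continuousM; [exact: cst_continuous|exact: continuous_gamma_density].
Qed.

Lemma Gamma1 : Gamma (1 : R) = 1.
Proof.
apply: (cvg_unique _ (cvg_Gamma_exhaust ltr01)) => //.
have -> : (fun n => \int[mu]_(t in exhaust n) gamma_density 1 t) =
  (fun n => expR (- n.+2%:R^-1) - expR (- n.+2%:R)).
  apply/funext => n; rewrite /Rintegral.
  have dF t : 0 < t -> is_derive t 1 (fun u : R => - expR (- u)) (gamma_density 1 t).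
    move=> t0; rewrite /gamma_density subrr powRr0 mul1r.
    have de : is_derive t 1 (fun u : R => expR (- u)) (- expR (- t)).
      by rewrite -mulrN1; apply: (@is_derive1_comp _ expR -%R).
    by have h := is_deriveN de; apply: (is_derive_eq h); rewrite opprK.
  rewrite (integral_exhaust_FTC _ dF)/=.
    by rewrite opprK addrC.
  by move=> t t0; exact: continuous_gamma_density.
have hn : - n.+2%:R^-1 @[n --> \oo] --> (0 : R).
  rewrite -[X in _ --> X]oppr0; apply: (@cvgN _ _ _ _ _ _ _ _).
  by have := @cvg_harmonic R; rewrite -cvg_shiftS.
have h : expR (- n.+2%:R^-1) - expR (- n.+2%:R) @[n --> \oo] --> (1 - 0 : R).
  apply: cvgB; last by have := @cvgn_expR R; rewrite -2!cvg_shiftS.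
  by rewrite -[X in _ --> X]expR0; exact: (cvg_comp _ _ hn (@continuous_expR R 0)).
by rewrite subr0 in h.
Qed.

(** A vanishing integral would make the density zero almost everywhere; being positive on the whole
    half-line, it would force that half-line to be negligible. *)
Lemma Gamma_gt0 x : 0 < x -> 0 < Gamma x.
Proof.
move=> x0; rewrite lt_neqAle Rintegral_ge0; last first.
  by move=> t _; exact: gamma_density_ge0.
rewrite andbT eq_sym; apply/eqP => G0.
have mG : measurable_fun (`]0, +oo[ : set R) (EFin \o gamma_density x).
  by apply/measurable_EFinP; exact: measurable_gamma_density.
have : (\int[mu]_(t in `]0%R, +oo[) `|(EFin \o gamma_density x) t| = 0)%E.
  transitivity ((Gamma x)%:E); last by rewrite G0.
  rewrite fineK; last first.
    by apply: integrable_fin_num => //; exact: integrable_gamma_density.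
  by apply: eq_integral => t _ /=; rewrite ger0_norm// gamma_density_ge0.
move/(ae_eq_integral_abs mu (measurable_itv _) mG).1 => ae0.
have : mu.-negligible (`]0, +oo[ : set R).
  apply: negligibleS ae0 => /=.
  move=> t /=; rewrite in_itv/= andbT => t0 /(_ t0)[].
  by apply/eqP; rewrite gt_eqF// mulr_gt0 ?powR_gt0 ?expR_gt0.
move=> N0; have /eqP : mu (`]0, +oo[ : set R) = 0%E.
  by apply: measure_negligible N0; exact: measurable_itv.
by rewrite lebesgue_measure_itv/= ltry.
Qed.

End gamma_function.

(** * Derivatives of Gamma under the integral sign *)

Section gamma_derivatives.
Context {R : realType}.
Implicit Types (e s t x y : R) (n : nat).
Local Notation mu := (@lebesgue_measure R).

(** For t > 0, the n-th derivative in x of the Gamma density. *)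
Definition log_gamma_density n x t : R := ln t ^+ n * gamma_density x t.

Definition Gamma_deriv n x : R :=
  \int[mu]_(t in `]0, +oo[) log_gamma_density n x t.

Lemma measurable_log_gamma_density n x (D : set R) :
  measurable_fun D (log_gamma_density n x).
Proof.
apply: measurable_funM; last exact: measurable_gamma_density.
by apply: measurable_funX; exact: measurable_funTS (@measurable_ln R).
Qed.

(** Take z^n <= n! e^z at z = e |ln t|; the exponential of z is the larger of t^e and t^-e. *)
Lemma normrX_ln_le n e t : 0 < e -> 0 < t ->
  `|ln t| ^+ n <= n`!%:R / e ^+ n * (t `^ e + t `^ (- e)).
Proof.
move=> e0 t0; have en : 0 < e ^+ n by rewrite exprn_gt0.
have f0 : 0 < n`!%:R :> R by rewrite ltr0n fact_gt0.
have xn (z : R) : 0 <= z -> z ^+ n <= n`!%:R * expR z.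
  move=> z0; rewrite mulrC -ler_pdivrMr//.
  case: n {en f0} => [|n]; first by rewrite expr0 fact0 divr1 -expR0 ler_expR.
  by have := expR_ge1Dxn n z0; lra.
have : expR (e * `|ln t|) <= t `^ e + t `^ (- e).
  rewrite /powR gt_eqF// mulNr.
  have := expR_ge0 (e * ln t); have := expR_ge0 (- (e * ln t)).
  by have [_|_] := ger0P (ln t); rewrite ?mulrN; lra.
have := xn (e * `|ln t|); rewrite (mulr_ge0 (ltW e0))// => /(_ isT).
rewrite exprMn => h1 h2; rewrite -mulrA mulrCA ler_pdivlMl//.
by apply: (le_trans h1); rewrite ler_pM2l.
Qed.

Lemma powR_interp_le (a b y t : R) : 0 < t -> a <= y <= b ->
  t `^ y <= t `^ a + t `^ b.
Proof.
move=> t0 /andP[ay yb]; have [t1|t1] := leP t 1.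
  by apply: ler_wpDr; [exact: powR_ge0|apply: ger_powR => //; rewrite t0].
by apply: ler_wpDl; [exact: powR_ge0|apply: ler_powR => //; exact: ltW].
Qed.

(* A factor |ln t|^n costs an arbitrarily small shift e of the exponent. *)
Lemma norm_log_gamma_density_le n e x y t : 0 < e -> 0 < t -> `|y - x| <= e ->
  `|log_gamma_density n y t| <= 2 * (n`!%:R / e ^+ n) *
    (gamma_density (x - 2 * e) t + gamma_density (x + 2 * e) t).
Proof.
move=> e0 t0; rewrite ler_norml => /andP[ey ye].
rewrite normrM (ger0_norm (gamma_density_ge0 _ _)) normrX.
have K0 : 0 <= n`!%:R / e ^+ n by rewrite divr_ge0// exprn_ge0 ?ltW.
have E0 := expR_ge0 (- t).
(* Moving from x to y and absorbing the logarithm each shift the exponent by at most e, whence the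
   2e. The bound serves for z = e and z = -e, whence the factor 2. *)
have pw (z : R) : `|z| <= e -> t `^ z * t `^ (y - 1) <=
    t `^ (x - 2 * e - 1) + t `^ (x + 2 * e - 1).
  rewrite ler_norml => /andP[ez ze].
  rewrite -powRD; last by rewrite (gt_eqF t0) implybT.
  by apply: powR_interp_le => //; apply/andP; split; lra.
have h := normrX_ln_le n e0 t0.
apply: (le_trans (ler_wpM2r (gamma_density_ge0 _ _) h)).
rewrite /gamma_density.
have := pw e; have := pw (- e); rewrite normrN (ger0_norm (ltW e0)) lexx.
move=> /(_ isT) p1 /(_ isT) p2.
move: K0; set K := _ / _ => K0.
rewrite [leLHS](_ : _ =
  K * ((t `^ e * t `^ (y - 1) + t `^ (- e) * t `^ (y - 1)) * expR (- t))); last by ring.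
rewrite [leRHS](_ : _ = K * (2 * (t `^ (x - 2 * e - 1) + t `^ (x + 2 * e - 1)) *
  expR (- t))); last by ring.
by rewrite ler_wpM2l// ler_wpM2r//; lra.
Qed.

Lemma integrable_gamma_densityD (K a b : R) : 0 < a -> 0 < b ->
  mu.-integrable `]0, +oo[
    (EFin \o (fun t => K * (gamma_density a t + gamma_density b t))).
Proof.
move=> a0 b0.
have iab : mu.-integrable `]0, +oo[
    (EFin \o (fun t => gamma_density a t + gamma_density b t)).
  exact: (integrableD _ (integrable_gamma_density a0) (integrable_gamma_density b0)).
exact: (integrableZl _ K iab).
Qed.

Lemma integrable_log_gamma_density n x : 0 < x ->
  mu.-integrable `]0, +oo[ (EFin \o log_gamma_density n x).
Proof.
(* With e = x/3, the lower exponent x - 2e is still positive. *)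
move=> x0; have e0 : 0 < x / 3 by rewrite divr_gt0.
have x1 : 0 < x - 2 * (x / 3) by lra.
have x2 : 0 < x + 2 * (x / 3) by lra.
have iG := integrable_gamma_densityD (2 * (n`!%:R / (x / 3) ^+ n)) x1 x2.
apply: le_integrable iG; first exact: measurable_itv.
  by apply/measurable_EFinP; exact: measurable_log_gamma_density.
move=> t; rewrite /= in_itv/= andbT => t0; rewrite lee_fin.
apply: le_trans (ler_norm _).
by apply: norm_log_gamma_density_le => //; rewrite subrr normr0 ltW.
Qed.

Lemma is_derive_affine (a b x : R) : is_derive x 1 (fun y => a * y + b) a.
Proof.
have h := is_deriveD (is_deriveZ a (is_derive_id x 1)) (is_derive_cst b x 1).
by apply: (is_derive_eq h); rewrite addr0 /GRing.scale/= mulr1.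
Qed.

Lemma is_derive_log_gamma_density n x t : 0 < t ->
  is_derive x 1 (log_gamma_density n ^~ t) (log_gamma_density n.+1 x t).
Proof.
move=> t0.
(* In the variable x, the density is a constant times the exponential of an affine function of slope
   ln t. *)
have -> : log_gamma_density n ^~ t =
  (fun y => ln t ^+ n * expR (- t) * expR (ln t * y + - ln t)).
  apply/funext => y; rewrite (_ : _ + - ln t = (y - 1) * ln t); last by ring.
  rewrite /log_gamma_density /gamma_density /powR gt_eqF//.
  by ring.
have h1 := @is_derive1_comp _ expR _ _ _ _ (is_derive_expR _)
  (is_derive_affine (ln t) (- ln t) x).
have h2 := is_deriveZ (ln t ^+ n * expR (- t)) h1.
apply: (is_derive_eq h2).
rewrite /log_gamma_density /gamma_density /powR gt_eqF// /GRing.scale/= exprS.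
rewrite (_ : _ + - ln t = (x - 1) * ln t); last by ring.
by ring.
Qed.

(** Differentiation under the integral sign: for y within e = x/3 of x, the single integrable
    function G dominates the partial derivatives. *)
Lemma is_derive_Gamma_deriv n x : 0 < x ->
  is_derive x 1 (Gamma_deriv n) (Gamma_deriv n.+1 x).
Proof.
move=> x0; pose e := x / 3; have e0 : 0 < e by rewrite divr_gt0.
have xe : x = 3 * e by rewrite /e; field.
pose K : R := 2 * (n.+1`!%:R / e ^+ n.+1).
pose G t := K * (gamma_density (x - 2 * e) t + gamma_density (x + 2 * e) t).
have Ix : `](x - e), (x + e)[%classic x.
  by rewrite /= in_itv/=; apply/andP; split; lra.
have K0 : 0 <= K by rewrite mulr_ge0// divr_ge0// exprn_ge0 ?ltW.
have G0 t : 0 <= G t by rewrite mulr_ge0// addr_ge0 ?gamma_density_ge0.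
have iG : mu.-integrable `]0, +oo[ (EFin \o G).
  have x1 : 0 < x - 2 * e by lra.
  have x2 : 0 < x + 2 * e by lra.
  exact: integrable_gamma_densityD.
have intf y : `](x - e), (x + e)[%classic y ->
    mu.-integrable `]0, +oo[ (EFin \o log_gamma_density n y).
  rewrite /= in_itv/= => /andP[? ?]; apply: integrable_log_gamma_density; lra.
have dfy y t : `](x - e), (x + e)[%classic y -> `]0, +oo[%classic t ->
    derivable (log_gamma_density n ^~ t) y 1.
  rewrite /= !in_itv/= andbT => _ t0.
  by have [] := is_derive_log_gamma_density n y t0.
have dE y t : 0 < t -> partial1of2 (log_gamma_density n) y t = log_gamma_density n.+1 y t.
  by move=> t0; rewrite partial1of2E; have [] := is_derive_log_gamma_density n y t0.
have Gub y t : `](x - e), (x + e)[%classic y -> `]0, +oo[%classic t ->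
    `|partial1of2 (log_gamma_density n) y t| <= G t.
  rewrite /= !in_itv/= andbT => /andP[? ?] t0; rewrite dE//.
  apply: norm_log_gamma_density_le => //.
  by rewrite ler_norml; apply/andP; split; lra.
apply: DeriveDef.
  by apply: (derivable_under_integral _ Ix intf dfy G0 iG Gub); exact: measurable_itv.
rewrite -derive1E (differentiation_under_integral _ Ix intf dfy G0 iG Gub);
  last exact: measurable_itv.
by apply: eq_Rintegral => t; rewrite inE/= in_itv/= andbT => t0; rewrite -dE.
Qed.

End gamma_derivatives.

(** * Complete Bell polynomials *)

Section bell_polynomials.
Context {R : realType}.
Implicit Types (s : nat -> R) (M N n i m : nat).

Definition bell_egf N s : {poly R} :=
  \poly_(j < N.+1) (if j == 0%N then 0 else s j / j`!%:R).

(* Decoupling the truncation M of the exponential from the truncation N of the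
   generating function makes deriv_bell_exp an exact identity. *)
Definition bell_exp M N s : {poly R} :=
  \sum_(m < M) (m`!%:R)^-1 *: bell_egf N s ^+ m.

Lemma coef_bell_egf N s j :
  (bell_egf N s)`_j = if (0 < j <= N)%N then s j / j`!%:R else 0.
Proof. by rewrite coef_poly ltnS; case: j => [|j]; case: leqP. Qed.

Lemma coef_exp_lt (p : {poly R}) m i : p`_0 = 0 -> (i < m)%N -> (p ^+ m)`_i = 0.
Proof.
move=> p0; elim: m i => // m IH i im.
rewrite exprS coefM big1// => j _.
have [->|j0] := eqVneq (val j) 0%N; first by rewrite p0 mul0r.
rewrite IH ?mulr0//.
by move: (ltn_ord j) j0 im; case: j => -[|j] //= _; lia.
Qed.

Lemma eq_coef_exp (p q : {poly R}) n :
  (forall i, (i <= n)%N -> p`_i = q`_i) ->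
  forall m i, (i <= n)%N -> (p ^+ m)`_i = (q ^+ m)`_i.
Proof.
move=> pq; elim=> // m IH i il; rewrite !exprS !coefM.
by apply: eq_bigr => j _; rewrite pq ?IH//; have := ltn_ord j; lia.
Qed.

(** The generating function has no constant term, so its m-th power starts in degree m; and
    coefficients up to n of a power depend only on those up to n of the base. *)
Lemma coef_bell_exp M N n s : (n < M)%N -> (n <= N)%N ->
  (bell_exp M N s)`_n = bell n s / n`!%:R.
Proof.
move=> nM nN; rewrite /bell mulrC mulKf ?pnatr_eq0 -?lt0n ?fact_gt0//.
rewrite /bell_exp !coef_sum.
rewrite [RHS](big_ord_widen M (fun m => ((m`!%:R)^-1 *: bell_egf n s ^+ m)`_n))//.
rewrite [RHS]big_mkcond; apply: eq_bigr => m _; rewrite !coefZ ltnS; case: leqP => nm.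
  congr (_ * _); apply: (@eq_coef_exp _ _ n) => // i il.
  by rewrite !coef_bell_egf il (leq_trans il nN).
by rewrite coef_exp_lt ?mulr0// coef_bell_egf.
Qed.

Lemma bell0 s : bell 0 s = 1.
Proof.
rewrite /bell big_ord_recl big_ord0 addr0 expr0 coefZ coef1 /= fact0.
by rewrite invr1 !mulr1.
Qed.

Lemma fact_neq0 n : n`!%:R != 0 :> R.
Proof. by rewrite pnatr_eq0 -lt0n fact_gt0. Qed.

(** Truncated form of (exp P)' = P' exp P: differentiation sends the term P^(m+1)/(m+1)! to P'
    P^m/m!, so one term is lost. *)
Lemma deriv_bell_exp M N s :
  deriv (bell_exp M.+1 N s) = deriv (bell_egf N s) * bell_exp M N s.
Proof.
rewrite /bell_exp big_ord_recl expr0 derivD derivZ derivC scaler0 add0r.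
rewrite raddf_sum mulr_sumr; apply: eq_bigr => m _ /=.
rewrite derivZ deriv_exp /= -scalerAr /bump /= add1n add0n -mulrnAr.
rewrite -[_ ^+ _ *+ _]scaler_nat -scalerAr scalerA; congr (_ *: _).
by rewrite factS natrM invfM mulrAC mulVf ?mul1r// pnatr_eq0.
Qed.

(** Compare the coefficients of t^n in (exp P)' = P' exp P. The later facts on Bell polynomials rest
    on this recurrence. *)
Lemma bellS n s :
  bell n.+1 s = \sum_(i < n.+1) 'C(n, i)%:R * bell i s * s (n.+1 - i)%N.
Proof.
have := congr1 (fun p : {poly R} => p`_n) (deriv_bell_exp n.+1 n.+1 s).
rewrite coef_deriv coef_bell_exp// coefMr.
rewrite -[_ *+ n.+1]mulr_natr factS natrM.
rewrite [X in X = _ -> _](_ : _ = bell n.+1 s / n`!%:R); last first.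
  by field; rewrite fact_neq0/= addrC natr1 pnatr_eq0.
move=> /(congr1 (fun x => n`!%:R * x)); rewrite mulrCA divff ?fact_neq0// mulr1 => ->.
rewrite mulr_sumr; apply: eq_bigr => i _.
have il : (i <= n)%N by rewrite -ltnS.
rewrite coef_deriv coef_bell_exp ?(leqW il)// coef_bell_egf -subSn// leq_subr.
rewrite subn_gt0 ltnS il /= subSn// factS.
rewrite -(bin_fact il) !natrM -[_ *+ (n - i).+1]mulr_natr.
have := fact_neq0 i; have := fact_neq0 (n - i).
have : (n - i).+1%:R != 0 :> R by rewrite pnatr_eq0.
move=> ? ? ?; field.
by apply/and3P.
Qed.

(** Corresponds to replacing t by ct in the generating function. With c = -1 it extracts the signs
    left by [xibarE]. *)
Lemma bell_scale (c : R) s n : bell n (fun j => c ^+ j * s j) = c ^+ n * bell n s.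
Proof.
elim/ltn_ind: n => [[|n]] IH; first by rewrite !bell0 expr0 mulr1.
rewrite !bellS mulr_sumr; apply: eq_bigr => i _.
rewrite IH; last by exact: ltn_ord.
have -> : c ^+ n.+1 = c ^+ i * c ^+ (n.+1 - i).
  by rewrite -exprD subnKC// ltnW.
by ring.
Qed.

Lemma eq_bell s s' n : (forall j, (0 < j <= n)%N -> s j = s' j) ->
  bell n s = bell n s'.
Proof.
elim/ltn_ind: n => [[|n]] IH eqs; first by rewrite !bell0.
rewrite !bellS; apply: eq_bigr => i _.
rewrite eqs; last by have := ltn_ord i; lia.
by rewrite IH// => j hj; apply: eqs; have := ltn_ord i; lia.
Qed.

End bell_polynomials.

(** * Iterated derivatives *)

Section iterated_derivatives.
Context {R : realType} (U : set R) (oU : open U).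
Implicit Types (F G L : nat -> R -> R) (f g : R -> R) (n : nat).

(** A function [F 0] bundled with all its derivatives on V, so that calculus rules act on whole
    sequences. *)
Definition derivs (V : set R) F := forall n x, V x -> is_derive x 1 (F n) (F n.+1 x).

(** Agreement on the open set U holds near each of its points, hence survives one more
    differentiation. *)
Lemma derive1n_derivs F f : derivs U F -> (forall x, U x -> f x = F 0%N x) ->
  forall n x, U x -> derive1n n f x = F n x.
Proof.
move=> dF f0; elim=> [|n IH] x Ux; first exact: f0.
rewrite derive1nS derive1E; have [_ <-] := dF n x Ux.
apply: near_eq_derive; have := open_nbhs_nbhs (conj oU Ux).
by apply: filterS => y Uy; exact: IH.
Qed.

Lemma eq_derivs F G : derivs U F -> derivs U G ->
  (forall x, U x -> F 0%N x = G 0%N x) -> forall n x, U x -> F n x = G n x.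
Proof.
move=> dF dG FG n x Ux; rewrite -(derive1n_derivs (f := F 0%N) dF)//.
exact: derive1n_derivs.
Qed.

(** Counts derivatives without naming them: this gives the smoothness of ln Gamma without explicit
    formulas, and [derivs_smooth] then returns to [derivs]. *)
Fixpoint smooth n f := if n is n'.+1 then
  (forall x, U x -> derivable f x 1) /\ smooth n' (derive1 f) else True.

Lemma eq_smooth n f g : (forall x, U x -> f x = g x) -> smooth n f -> smooth n g.
Proof.
elim: n f g => //= n IH f g fg [df sf].
have nfg x : U x -> \near x, f x = g x.
  by move=> Ux; have := open_nbhs_nbhs (conj oU Ux); exact: filterS.
split=> [x Ux|]; first by apply: near_eq_derivable (df x Ux); exact: nfg.
by apply: IH sf => x Ux; rewrite !derive1E; apply: near_eq_derive; exact: nfg.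
Qed.

Lemma smoothS n f g : (forall x, U x -> is_derive x 1 f (g x)) ->
  smooth n g -> smooth n.+1 f.
Proof.
move=> df sg; split=> [x /df[]//|].
by apply: eq_smooth sg => x /df[_ <-]; rewrite derive1E.
Qed.

Lemma smoothP n f x : smooth n.+1 f -> U x -> is_derive x 1 f (derive1 f x).
Proof. by move=> [df _] Ux; apply: DeriveDef; [exact: df|rewrite derive1E]. Qed.

Lemma smoothW n f : smooth n.+1 f -> smooth n f.
Proof. by elim: n f => // n IH f [df sf]; split => //; exact: IH. Qed.

Lemma smoothN n f : smooth n f -> smooth n (fun x => - f x).
Proof.
elim: n f => // n IH f sf.
have d x : U x -> is_derive x 1 (fun x => - f x) (- derive1 f x).
  by move=> Ux; exact: (is_deriveN (smoothP sf Ux)).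
by apply: (smoothS d); apply: IH; have [] := sf.
Qed.

Lemma smoothD n f g : smooth n f -> smooth n g -> smooth n (fun x => f x + g x).
Proof.
elim: n f g => // n IH f g sf sg.
have d x : U x -> is_derive x 1 (fun x => f x + g x) (derive1 f x + derive1 g x).
  by move=> Ux; exact: (is_deriveD (smoothP sf Ux) (smoothP sg Ux)).
by apply: (smoothS d); apply: IH; [have [] := sf|have [] := sg].
Qed.

Lemma smoothM n f g : smooth n f -> smooth n g -> smooth n (fun x => f x * g x).
Proof.
elim: n f g => // n IH f g sf sg.
have d x : U x -> is_derive x 1 (fun x => f x * g x)
    (f x * derive1 g x + g x * derive1 f x).
  by move=> Ux; exact: (is_deriveM (smoothP sf Ux) (smoothP sg Ux)).
by apply: (smoothS d); apply: smoothD; apply: IH;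
  [exact: smoothW|have [] := sg|exact: smoothW|have [] := sf].
Qed.

Lemma smoothV n f : (forall x, U x -> f x != 0) -> smooth n f ->
  smooth n (fun x => (f x)^-1).
Proof.
move=> f0; elim: n => // n IH sf.
have d x : U x -> is_derive x 1 (fun x => (f x)^-1)
    (- ((f x)^-1 * (f x)^-1 * derive1 f x)).
  move=> Ux; apply: (is_derive_eq (is_deriveV (f0 x Ux) (smoothP sf Ux))).
  by rewrite scaleNr -invfM -expr2.
(* The derivative -f'/f^2 contains 1/f again, needed only one order lower. *)
have sV := IH (smoothW sf).
by apply: (smoothS d); apply: smoothN; apply: smoothM; [exact: smoothM|have [] := sf].
Qed.

Lemma smooth_ln n f : (forall x, U x -> 0 < f x) -> smooth n f ->
  smooth n (fun x => ln (f x)).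
Proof.
move=> f0; case: n => // n sf.
have d x : U x -> is_derive x 1 (fun x => ln (f x)) ((f x)^-1 * derive1 f x).
  by move=> Ux; exact: (is_derive1_comp (is_derive1_ln (f0 x Ux)) (smoothP sf Ux)).
apply: (smoothS d); apply: smoothM; last by have [] := sf.
by apply: smoothV => [x /f0/lt0r_neq0//|]; exact: smoothW.
Qed.

Lemma smooth_derivs F n i : derivs U F -> smooth n (F i).
Proof.
move=> dF; by elim: n i => // n IH i; apply: (smoothS (dF i)).
Qed.

Lemma derivs_smooth f : (forall n, smooth n f) -> derivs U (fun n => derive1n n f).
Proof.
move=> sf n; have {sf} := sf n.+1; elim: n f => [|n IH] f sf x Ux.
  exact: smoothP sf Ux.
by have := IH (derive1 f) sf.2 x Ux; rewrite /derive1n -!iterSr.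
Qed.

Lemma derivsD F G : derivs U F -> derivs U G -> derivs U (fun n x => F n x + G n x).
Proof. by move=> dF dG n x Ux; exact: (is_deriveD (dF n x Ux) (dG n x Ux)). Qed.

Lemma derivsB F G : derivs U F -> derivs U G -> derivs U (fun n x => F n x - G n x).
Proof. by move=> dF dG n x Ux; exact: (is_deriveB (dF n x Ux) (dG n x Ux)). Qed.

Lemma derivs_affine (V : set R) F (a b : R) : derivs V F ->
  (forall x, U x -> V (a * x + b)) -> derivs U (fun n x => a ^+ n * F n (a * x + b)).
Proof.
move=> dF UV n x Ux.
have h := is_deriveZ (a ^+ n)
  (@is_derive1_comp _ (F n) _ x _ _ (dF n _ (UV x Ux)) (is_derive_affine a b x)).
by apply: (is_derive_eq h); rewrite /GRing.scale/= exprSr; ring.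
Qed.

(** Leibniz' rule for the factor x. At n = 0 the default [n.-1] = 0 is harmless, its coefficient
    being 0. *)
Lemma derivs_mulid F : derivs U F ->
  derivs U (fun n x => x * F n x + n%:R * F n.-1 x).
Proof.
move=> dF n x Ux.
have h1 := is_deriveM (is_derive_id x 1) (dF n x Ux).
have h2 : is_derive x 1 (n%:R \*: F n.-1) (n%:R * F n x).
  case: n {h1} => [|n]; last exact: (is_deriveZ _ (dF n x Ux)).
  by rewrite mul0r; have := is_deriveZ (0 : R) (dF 0%N x Ux); rewrite scale0r.
apply: (is_derive_eq (is_deriveD h1 h2)).
by rewrite /GRing.scale/= -natr1; ring.
Qed.

(** Pascal's rule regroups what the product rule yields when the recurrence [bellS] is
    differentiated. *)
Lemma pascal_sum (a b : nat -> R) n :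
  \sum_(i < n.+1) 'C(n, i)%:R * (a i * b (n.+2 - i)%N + a i.+1 * b (n.+1 - i)%N) =
  \sum_(i < n.+2) 'C(n.+1, i)%:R * (a i * b (n.+2 - i)%N).
Proof.
rewrite [RHS]big_ord_recl /=.
under [in RHS]eq_bigr do rewrite /bump /= add1n binS natrD mulrDl subSS.
under eq_bigr do rewrite mulrDr.
rewrite !big_split /= addrA; congr (_ + _).
rewrite [in RHS]big_ord_recr /= (bin_small (ltnSn n)) mul0r addr0.
rewrite big_ord_recl /= !bin0; congr (_ + _).
Qed.

(** Faà di Bruno's formula for the exponential. By [bellS], [H n.+1] is a sum of products of earlier
    [H i] with derivatives of L, so strong induction and the product rule apply. *)
Lemma derivs_exp (c : R) L : derivs U L ->
  derivs U (fun n x => c * expR (L 0%N x) * bell n (L ^~ x)).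
Proof.
move=> dL; set H := (H in derivs U H).
have HS n : H n.+1 =
    \sum_(i < n.+1) ('C(n, i)%:R \*: (fun x => H i x * L (n.+1 - i)%N x)).
  apply/funext => x; rewrite fct_sumE /H bellS mulr_sumr.
  by apply: eq_bigr => i _ /=; rewrite /GRing.scale/=; ring.
move=> n x Ux; elim/ltn_ind: n => -[_|n IH].
  have h := is_deriveZ c (is_derive1_comp (is_derive_expR (L 0%N x)) (dL 0%N x Ux)).
  rewrite HS big_ord1 /=.
  rewrite (_ : H 0%N = c \*: (expR \o L 0%N)); last first.
    by apply/funext => y; rewrite /H bell0 mulr1.
  apply: (is_derive_eq h).
  by rewrite /GRing.scale/= bin0 mul1r mulrA.
rewrite {1}HS.
have dH (i : 'I_n.+1) : is_derive x 1
    ('C(n, i)%:R \*: (fun x => H i x * L (n.+1 - i)%N x))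
    ('C(n, i)%:R * (H i x * L (n.+2 - i)%N x + H i.+1 x * L (n.+1 - i)%N x)).
  have h := is_deriveZ ('C(n, i)%:R : R)
    (is_deriveM (IH i (ltn_ord i)) (dL (n.+1 - i)%N x Ux)).
  apply: (is_derive_eq h); rewrite -subSn 1?ltnW//.
  by rewrite /GRing.scale/= [X in _ + X]mulrC.
apply: (is_derive_eq (is_derive_sum dH)).
rewrite (pascal_sum (H ^~ x) (L ^~ x)) HS fct_sumE.
by apply: eq_bigr.
Qed.

End iterated_derivatives.

(** * Logarithmic derivatives of the binomial coefficient *)

Section log_gamma.
Context {R : realType}.
Implicit Types (x : R) (n N d : nat).

Let pos : set R := `]0, +oo[.
Let pos_open : open pos. Proof. exact: interval_open. Qed.
Let posE x : pos x = (0 < x) :> Prop. Proof. by rewrite /pos/= in_itv/= andbT. Qed.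

(** The index is shifted: [polygamma n] is [lnGamma_deriv n.+1], and index 0 is ln Gamma itself. *)
Definition lnGamma_deriv n : R -> R := derive1n n (fun y => ln (Gamma y)).

Lemma derivs_lnGamma : derivs pos lnGamma_deriv.
Proof.
apply: derivs_smooth => n; apply: smooth_ln => //.
  by move=> x; rewrite posE; exact: Gamma_gt0.
have dG : derivs pos (@Gamma_deriv R).
  by move=> m x; rewrite posE; exact: is_derive_Gamma_deriv.
apply: (eq_smooth pos_open _ (smooth_derivs pos_open n 0 dG)) => x _.
rewrite /Gamma_deriv /Gamma; apply: eq_Rintegral => t _.
by rewrite /log_gamma_density expr0 mul1r.
Qed.

(** Differentiate lnG(x+1) = lnG(x) + ln x; [D] lists the derivatives of ln. *)
Lemma lnGamma_derivD1 n x : 0 < x ->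
  lnGamma_deriv n.+1 (x + 1) =
  lnGamma_deriv n.+1 x + (-1) ^+ n * n`!%:R / x ^+ n.+1.
Proof.
move=> x0.
pose A m y := (1 : R) ^+ m * lnGamma_deriv m (1 * y + 1).
pose D m y : R := if m is m'.+1 then (-1) ^+ m' * m'`!%:R * (y ^+ m'.+1)^-1 else ln y.
have dA : derivs pos A.
  by apply: derivs_affine derivs_lnGamma _ => y; rewrite !posE; lra.
have dD : derivs pos D.
  move=> [|m] y; rewrite posE => y0.
    by rewrite /D expr0 fact0 !mul1r expr1; exact: is_derive1_ln.
  have y1 : y ^+ m.+1 != 0 by rewrite expf_neq0// gt_eqF.
  have hX : is_derive y 1 (fun y : R => y ^+ m.+1) (m.+1%:R * y ^+ m).
    by have := is_deriveX m.+1 (is_derive_id y 1); rewrite exprfctE /GRing.scale/= mulr1.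
  have h := is_deriveZ ((-1) ^+ m * m`!%:R) (is_deriveV (f := fun y => y ^+ m.+1) y1 hX).
  apply: (is_derive_eq h); rewrite /GRing.scale/= factS natrM !exprS.
  have ym : y ^+ m != 0 by rewrite expf_neq0// gt_eqF.
  have : y != 0 by rewrite gt_eqF.
  by move=> yn; field; rewrite yn ym.
have E0 y : pos y -> A 0%N y = lnGamma_deriv 0 y + D 0%N y.
  rewrite posE => y0; rewrite /A /D expr0 !mul1r /lnGamma_deriv !derive1n0.
  by rewrite GammaD1// lnM ?posrE ?Gamma_gt0// addrC.
have := eq_derivs pos_open dA (derivsD derivs_lnGamma dD) E0 n.+1.
by move=> /(_ x); rewrite posE => /(_ x0); rewrite /A expr1n !mul1r.
Qed.

Lemma GammaDn n x : 0 < x -> Gamma (x + n%:R) = \prod_(i < n) (x + i%:R) * Gamma x.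
Proof.
move=> x0; elim: n => [|n IH]; first by rewrite big_ord0 addr0 mul1r.
have xn : 0 < x + n%:R by rewrite ltr_wpDr.
by rewrite -[n.+1%:R]natr1 addrA (GammaD1 xn) IH big_ord_recr /=; ring.
Qed.

(** Once the shifted point is positive, a further shift multiplies numerator and denominator by the
    same factor, so all admissible shifts agree. *)
Lemma rgammaE n x : 0 < x + n%:R ->
  rgamma x = \prod_(i < n) (x + i%:R) / Gamma (x + n%:R).
Proof.
pose r m := \prod_(i < m) (x + i%:R) / Gamma (x + m%:R).
have rD m d : 0 < x + m%:R -> r (m + d)%N = r m.
  move=> xm; elim: d => [|d <-]; first by rewrite addn0.
  have xmd : 0 < x + (m + d)%:R by rewrite natrD addrA ltr_wpDr.
  rewrite /r addnS big_ord_recr /= -[(m + d).+1%:R]natr1 addrA (GammaD1 xmd).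
  have := Gamma_gt0 xmd => G0; field.
  by rewrite !gt_eqF// -natrD.
move=> xn.
have xs : 0 < x + (rgamma_shift x)%:R.
  rewrite /rgamma_shift -natr1 natr_absz intr_norm.
  have := ler_norm (- (Num.floor x)%:~R : R); rewrite normrN.
  have := floor_le x; lra.
rewrite -[RHS]/(r n) -[LHS]/(r (rgamma_shift x)).
have [le|/ltnW le] := leqP n (rgamma_shift x).
  by rewrite -(subnKC le) rD.
by rewrite -(subnKC le) rD.
Qed.

Lemma rgamma_gt0E x : 0 < x -> rgamma x = (Gamma x)^-1.
Proof. by move=> x0; rewrite (@rgammaE 0) ?addr0// big_ord0 mul1r. Qed.

(** The n-th derivative of the exponent L; the factors [1 ^+ n] and [1 * x] fit the shape of
    [derivs_affine]. *)
Definition lnCbin_deriv (k : nat) n x : R :=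
  2 ^+ n * lnGamma_deriv n (2 * x + 1)
  - 1 ^+ n * lnGamma_deriv n (1 * x + (k%:R + 1))
  - 1 ^+ n * lnGamma_deriv n (1 * x + 1)
  + (-1) ^+ n * lnGamma_deriv n (-1 * x + k%:R)
  - (-1) ^+ n * lnGamma_deriv n (-1 * x + 1).

(** The radius 1/2 keeps 2x+1 positive, and with it the other Gamma arguments in L for k >= 1. *)
Let near0 : set R := `](- 2^-1), 2^-1[.

Let near0P x : near0 x -> - 2^-1 < x < 2^-1.
Proof. by rewrite /near0/= in_itv. Qed.

Lemma derivs_lnCbin k : (0 < k)%N -> derivs near0 (lnCbin_deriv k).
Proof.
move=> k0; have k1 : 1 <= k%:R :> R by rewrite ler1n.
by apply: derivsB; first (apply: derivsD; first (apply: derivsB; first apply: derivsB));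
  apply: derivs_affine derivs_lnGamma _ => x /near0P/andP[? ?]; rewrite posE; lra.
Qed.

Lemma expR_lnCbin k x : near0 x -> (0 < k)%N ->
  expR (lnCbin_deriv k 0 x) =
  Gamma (2 * x + 1) / Gamma (x + (k%:R + 1)) / Gamma (x + 1) *
  Gamma (k%:R - x) / Gamma (1 - x).
Proof.
move=> /near0P/andP[xl xr] k0; have k1 : 1 <= k%:R :> R by rewrite ler1n.
have e y : 0 < y -> expR (lnGamma_deriv 0 y) = Gamma y.
  by move=> y0; rewrite lnK// posrE Gamma_gt0.
rewrite /lnCbin_deriv; move: (lnGamma_deriv 0) (@Gamma R) e => L G e.
rewrite !expr0 !mul1r !mulN1r ![- x + _]addrC expRB expRD !expRB.
by rewrite !e//; lra.
Qed.

(** Shifting x-k up to x+1 writes 1/Gamma(x-k) with k+1 factors. The last is x; the others are, up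
    to sign, those of Gamma(k+1-x)/Gamma(1-x) in reverse order. *)
Lemma CbinE k x : near0 x ->
  Cbin k.+1 x = x * ((-1) ^+ k * expR (lnCbin_deriv k.+1 0 x)).
Proof.
move=> nx; rewrite expR_lnCbin//; move: nx => /near0P/andP[xl xr].
have k1 : 0 <= k%:R :> R by [].
have y2 : 0 < x + k.+1%:R + 1 by rewrite -natr1; lra.
have y3 : 0 < x + 1 by lra.
have y5 : 0 < 1 - x by lra.
have y6 : x - k.+1%:R + 1 + k.+1%:R = x + 1 by ring.
rewrite /Cbin (rgamma_gt0E y2) (rgammaE (n := k.+1)) y6//.
have -> : k.+1%:R - x = 1 - x + k%:R by rewrite -natr1; ring.
rewrite (GammaDn k y5) big_ord_recr /= addrA.
have -> : \prod_(i < k) (x - k.+1%:R + 1 + i%:R) =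
    (-1) ^+ k * \prod_(i < k) (1 - x + i%:R).
  rewrite -[k in (-1) ^+ k]card_ord -prodrN (reindex_inj rev_ord_inj) /=.
  by apply: eq_bigr => i _; rewrite natrB// -!natr1; ring.
have := Gamma_gt0 y5; have := Gamma_gt0 y3; have := Gamma_gt0 y2.
move: (@Gamma R) => G g2 g3 g5.
rewrite -[k.+1%:R]natr1 in g2 *; field.
by rewrite !gt_eqF.
Qed.

Lemma expR_lnCbin0 k : (0 < k)%N -> expR (lnCbin_deriv k 0 0) = k%:R^-1.
Proof.
move=> k0; have kp : 0 < k%:R :> R by rewrite ltr0n.
rewrite expR_lnCbin//; last by rewrite /near0/= in_itv/=; apply/andP; split; lra.
rewrite mulr0 !add0r !subr0 Gamma1 (GammaD1 kp).
have := Gamma_gt0 kp; move: (Gamma k%:R) => G G0; field.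
by rewrite !gt_eqF.
Qed.

(* The digamma recurrence at k, from lnG(m+k+1), yields the term (j-1)!/k^j. *)
Lemma xibarE k j : (0 < k)%N -> (0 < j)%N ->
  @xibar R k j = (-1) ^+ j * lnCbin_deriv k j 0.
Proof.
case: j => // j k0 _; have kp : 0 < k%:R :> R by rewrite ltr0n.
rewrite /xibar /lnCbin_deriv succnK !mulr0 !add0r (lnGamma_derivD1 _ kp).
rewrite -[polygamma j 1]/(lnGamma_deriv j.+1 1).
rewrite -[polygamma j k%:R]/(lnGamma_deriv j.+1 k%:R).
move: (lnGamma_deriv _ 1) (lnGamma_deriv _ k%:R) => l1 lk.
(* At order J = j+1, [lk] has coefficient 1 - (-1)^J and [l1] has (-2)^J - 1 - (-1)^J, which the
   parity of J turns into the brackets. *)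
rewrite expr1n !mul1r -[-2]mulN1r exprMn ![(-1) ^+ j.+1]exprS /=.
by rewrite -signr_odd; case: (odd j); rewrite /= ?expr0 ?expr1; ring.
Qed.

End log_gamma.

Theorem theorem4 (R : realType) (k p : nat) (hk : (0 < k)%N) (hp : (0 < p)%N) :
  derive1n p (@Cbin R k) 0 =
  (-1) ^+ (p + k) / k%:R * p%:R * @bell R p.-1 (@xibar R k).
Proof.
have U0 : (`](- 2^-1), 2^-1[%classic : set R) 0.
  by rewrite /= in_itv/=; apply/andP; split; lra.
case: k hk => // k _; case: p hp => // p _.
have dH := derivs_exp ((-1) ^+ k) (@derivs_lnCbin R _ (ltn0Sn k)).
rewrite (derive1n_derivs (interval_open _ _) (derivs_mulid dH) _ _ U0)//=; last first.
  by move=> x Ux; rewrite CbinE// bell0 mulr1 mul0r addr0.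
(* At 0 the term x F_n of Leibniz' rule vanishes, leaving p times the derivative of order p-1 of the
   exponential factor. *)
rewrite mul0r add0r expR_lnCbin0//.
rewrite (@eq_bell _ (@xibar R k.+1)
  (fun j => (-1) ^+ j * lnCbin_deriv k.+1 j 0)); last first.
  by move=> j /andP[j0 _]; exact: xibarE.
rewrite bell_scale addSn addnS !exprS exprD.
have : (-1) ^+ p * (-1) ^+ p = 1 :> R by rewrite -expr2 sqrr_sign.
move=> s; ring: s.
Qed.
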